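(* Let $r\in\{3,4,\ldots\}$ and let $\rho_1,\ldots,\rho_r$ be pairwise commuting quantum states. Then $$F_{2,r}\ \ge\ F_{3,r}\ \ge\ \cdots\ \ge\ F_{r-1,r}\ \ge\ F_{r,r},$$ where $F_{k,r}=F_{k,r}(\rho_1,\ldots,\rho_r)$ is the average $k$-wise fidelity.
   Context: A quantum state is a positive semi-definite operator of unit trace on a finite-dimensional complex Hilbert space; all states in the tuple act on the same space. For commuting states, $(\rho_i(x))_x$ denotes the eigenvalues of $\rho_i$ in a common eigenbasis. For $k\in\{2,\ldots,r\}$ the average $k$-wise fidelity is $$F_{k,r}(\rho_1,\ldots,\rho_r)=\binom{r}{k}^{-1}\sum_{i_1<i_2<\cdots<i_k}F_k(\rho_{i_1},\ldots,\rho_{i_k}),\qquad F_k(\rho_{i_1},\ldots,\rho_{i_k})=\sum_x\left(\rho_{i_1}(x)\cdots\rho_{i_k}(x)\right)^{1/k},$$ where the outer sum is over all $1\le i_1<\cdots<i_k\le r$. *)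

(* Defs.v *)
From HB Require Import structures.
From mathcomp Require Import all_boot all_order all_algebra.
From mathcomp Require Import mxred sesquilinear spectral complex.
From mathcomp Require Import boolp classical_sets reals exp.

Set Implicit Arguments.
Unset Strict Implicit.
Unset Printing Implicit Defensive.

Import Order.TTheory GRing.Theory Num.Theory.

Local Open Scope ring_scope.
Local Open Scope complex_scope.
Local Open Scope sesquilinear_scope.

Section States.
Variables (R : realType) (d : nat).
Implicit Type A : 'M[R[i]]_d.

(* The order on R[i] only compares numbers with equal imaginary parts, so the
   inequality also says that the quadratic form is real. *)
Definition psdmx A : Prop :=
  A \is hermsymmx /\ forall v : 'rV[R[i]]_d, 0 <= (v *m A *m v ^t*) 0 0.

Definition quantum_state A : Prop := psdmx A /\ \tr A = 1.

End States.

Section Fidelity.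
Variables (R : realType) (d r : nat) (rho : 'I_r -> 'M[R[i]]_d).
Implicit Types (U : 'M[R[i]]_d) (S : {set 'I_r}).

(* The basis vectors are the rows of U, operators acting on row vectors. *)
Definition common_eigenbasis U : Prop :=
  U \is unitarymx /\ forall i, similar_diag U (rho i).

(* For U unitary, conjmx U (rho i) = U *m rho i *m U^t*; its diagonal entries
   are real when rho i is Hermitian. *)
Definition eigval_in U (i : 'I_r) (x : 'I_d) : R :=
  complex.Re (conjmx U (rho i) x x).

Definition fidelity_in U S : R :=
  \sum_x (\prod_(i in S) eigval_in U i x) `^ (#|S|%:R^-1).

(* A chosen common eigenbasis: one exists for commuting states
   (common_eigenbasis_exists), and the choice is irrelevant (fidelityE). *)
Definition eigenbasis : 'M[R[i]]_d := xget 1%:M common_eigenbasis.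

(* F_k(rho_{i_1}, ..., rho_{i_k}), where S = {i_1 < ... < i_k}. *)
Definition fidelity S : R := fidelity_in eigenbasis S.

Definition avg_fidelity (k : nat) : R :=
  'C(r, k)%:R^-1 * \sum_(S : {set 'I_r} | #|S| == k) fidelity S.

End Fidelity.

Section WellDefined.
Variables (R : realType) (d r : nat) (rho : 'I_r -> 'M[R[i]]_d).
Implicit Types U V : 'M[R[i]]_d.

Lemma common_eigenbasis_exists :
    (forall i, quantum_state (rho i)) ->
    (forall i j, comm_mx (rho i) (rho j)) ->
  exists U, common_eigenbasis rho U.
Proof.
move=> rho_st rho_comm; have [|U U_unit] := @cotrigonalization _ d (codom rho).
  by move=> _ _ /codomP[i ->] /codomP[j ->]; apply: rho_comm.
move=> /allP/= U_trig; exists U; split=> // i.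
have /is_trig_mxP trigD : is_trig_mx (conjmx U (rho i)).
  exact/U_trig/codom_f.
apply/is_diag_mxP => x y; case: ltngtP => // [/trigD//|lt_yx] _.
have : conjmx U (rho i) = (conjmx U (rho i))^t*.
  have [[/is_hermitianmxP rhoE _] _] := rho_st i.
  rewrite conjymx // !trmx_mul !map_mxM trmxCK mulmxA.
  by rewrite [in LHS]rhoE expr0 scale1r.
move: (conjmx U (rho i)) trigD => D trigD /matrixP/(_ x y) ->.
by rewrite !mxE trigD// conjC0.
Qed.

Lemma common_eigenbasis_mul U i : common_eigenbasis rho U ->
  U *m rho i = diag_mx (\row_x conjmx U (rho i) x x) *m U.
Proof.
move=> [Uu /(_ i) /is_diag_mxP Ud].
rewrite -(mulmxKtV (U *m rho i) Uu (erefl d)); congr (_ *m _).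
rewrite -conjymx //; move: (conjmx U (rho i)) Ud => D Ud.
apply/matrixP => x y; rewrite !mxE.
case: eqVneq => [->|neq_xy]; first by rewrite mulr1n.
by rewrite mulr0n Ud.
Qed.

Lemma fidelity_in_uniq U V S :
    common_eigenbasis rho U -> common_eigenbasis rho V ->
  fidelity_in rho U S = fidelity_in rho V S.
Proof.
move=> Ue Ve; have [Uu _] := Ue; have [Vu _] := Ve.
pose W := V *m U^t*.
have Wu : W \is unitarymx by apply: mul_unitarymx => //; rewrite (trmxC_unitary U).
have WE i x y : W x y != 0 -> eigval_in rho U i y = eigval_in rho V i x.
  move=> Wxy; rewrite /eigval_in; congr complex.Re; apply: (mulfI Wxy).
  have: W *m diag_mx (\row_x conjmx U (rho i) x x)
      = diag_mx (\row_x conjmx V (rho i) x x) *m W.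
    have UU : U^t* *m U = 1%:M by exact: (mulmx1C (unitarymxP Uu)).
    rewrite mulmxA -(common_eigenbasis_mul i Ve) -!mulmxA; congr (_ *m _).
    rewrite -[LHS](mulmxtVK _ Uu) -(mulmxA (U^t*)).
    by rewrite -(common_eigenbasis_mul i Ue) mulmxA UU mul1mx.
  clearbody W; move: (conjmx U _) (conjmx V _) => DU DV /matrixP /(_ x y).
  by rewrite mul_mx_diag mul_diag_mx !mxE => ->; rewrite mulrC.
clearbody W.
pose f U x := (\prod_(i in S) eigval_in rho U i x) `^ (#|S|%:R^-1).
have fE x y : W x y != 0 -> f U y = f V x.
  by move=> Wxy; congr (_ `^ _); apply: eq_bigr => i _; apply: WE.
have row1 x : \sum_y `|W x y| ^+ 2 = 1.
  have /matrixP/(_ x x) := unitarymxP Wu; rewrite !mxE eqxx mulr1n => <-.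
  by apply: eq_bigr => y _; rewrite !mxE normCK.
have col1 y : \sum_x `|W x y| ^+ 2 = 1.
  have WCu : W^t* \is unitarymx by rewrite (trmxC_unitary W).
  have /matrixP/(_ y y) := unitarymxP WCu.
  rewrite !mxE eqxx mulr1n => <-.
  by apply: eq_bigr => x _; rewrite trmxCK !mxE normCKC.
rewrite -[LHS]/(\sum_y f U y) -[RHS]/(\sum_x f V x); clearbody f.
apply: (fmorph_inj (real_complex R)).
rewrite !(rmorph_sum (real_complex R)).
transitivity (\sum_y \sum_x `|W x y| ^+ 2 * (f V x)%:C).
  apply: eq_bigr => y _; rewrite -[LHS]mul1r -(col1 y) mulr_suml.
  apply: eq_bigr => x _; have [->|/fE -> //] := eqVneq (W x y) 0.
  by rewrite normr0 expr0n !mul0r.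
rewrite exchange_big; apply: eq_bigr => x _.
by rewrite -mulr_suml row1 mul1r.
Qed.

Lemma fidelityE U S : common_eigenbasis rho U ->
  fidelity rho S = fidelity_in rho U S.
Proof.
move=> Ue; have Ee : common_eigenbasis rho (eigenbasis rho).
  exact: (xgetPex _ (ex_intro _ U Ue)).
exact: (fidelity_in_uniq S Ee Ue).
Qed.

End WellDefined.

(* Main.v *)
Require Import Defs.
From mathcomp Require Import all_boot all_order all_algebra.
From mathcomp Require Import complex reals.
From mathcomp Require Import sesquilinear spectral exp.

(** In a common eigenbasis it is enough to prove the inequality for each tuple
    of nonnegative eigenvalues.  For a (k+1)-set T, the geometric mean over T is
    the geometric mean, over j in T, of the geometric means over the k-sets
    T \ j; AM-GM bounds it by their arithmetic mean.  Averaging over T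
    covers each k-set equally often. *)

Import Order.TTheory GRing.Theory Num.Theory.
Local Open Scope ring_scope.
Local Open Scope complex_scope.

Lemma powR_prod (R : realType) (I : Type) (s : seq I) (P : pred I) (F : I -> R)
    (p : R) : (forall i, P i -> 0 <= F i) ->
  (\prod_(i <- s | P i) F i) `^ p = \prod_(i <- s | P i) F i `^ p.
Proof.
move=> F_ge0; elim: s => [|i s IHs]; first by rewrite !big_nil powR1.
rewrite !big_cons; case: ifP => // Pi.
by rewrite powRM ?IHs ?F_ge0 ?prodr_ge0.
Qed.

(** Each factor [a i] with [i] in [T] is omitted only when [j = i], so it occurs [#|T|.-1] times. *)
Lemma prod_setD1 (R : comPzSemiRingType) (I : finType) (T : {set I})
    (a : I -> R) :
  \prod_(j in T) \prod_(i in T :\ j) a i = (\prod_(i in T) a i) ^+ #|T|.-1.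
Proof.
rewrite (exchange_big_dep (mem T)) /= => [|j i _ /setD1P[]//].
rewrite -prodrXl; apply: eq_bigr => i iT.
rewrite (eq_bigl (mem (T :\ i))) => [|j]; last first.
  by rewrite !inE iT andbT andbC eq_sym.
by rewrite prodr_const [in RHS](cardsD1 i) iT.
Qed.

(** Double counting: a [k]-set [S] arises as [T :\ j] exactly when [j] lies outside [S] and
    [T = j |: S], which leaves [#|I| - k] choices of [j]. *)
Lemma sum_setD1 (V : nmodType) (I : finType) (k : nat) (f : {set I} -> V) :
  \sum_(T : {set I} | #|T| == k.+1) \sum_(j in T) f (T :\ j)
  = (\sum_(S : {set I} | #|S| == k) f S) *+ (#|I| - k).
Proof.
rewrite (exchange_big_dep xpredT) //=.
transitivity (\sum_j \sum_(S : {set I} | (#|S| == k) && (j \notin S)) f S).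
  apply: eq_bigr => j _.
  rewrite (reindex_onto (fun S => j |: S) (fun T => T :\ j)) /=; last first.
    by move=> T /andP[_ jT]; rewrite setD1K.
  have setU1D1 (S : {set I}) : ((j |: S) :\ j == S) = (j \notin S).
    apply/eqP/idP => [<-|/setU1K//]; by rewrite setD11.
  apply: eq_big => [S|S /andP[_ /eqP ->]//].
  rewrite setU11 andbT setU1D1; case: (boolP (j \in S)); rewrite ?andbF // => jS.
  by rewrite cardsU1 jS.
rewrite (exchange_big_dep (fun S : {set I} => #|S| == k)) /= => [|? ? _ /andP[]//].
rewrite -sumrMnl; apply: eq_bigr => S /eqP cardS.
rewrite (eq_bigl (mem (~: S))) => [|j]; last by rewrite !inE cardS eqxx.
by rewrite sumr_const -(cardsC S) cardS addKn.
Qed.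

(** Kept convertible to the summand of [fidelity_in], with [a] the eigenvalues at a fixed basis
    index. *)
Definition geomean {R : realType} {I : finType} (a : I -> R) (S : {set I}) : R :=
  (\prod_(i in S) a i) `^ #|S|%:R^-1.

Lemma geomean_le_setD1 (R : realType) (I : finType) (a : I -> R) (k : nat)
    (T : {set I}) : (forall i, 0 <= a i) -> (0 < k)%N -> #|T| = k.+1 ->
  geomean a T <= k.+1%:R^-1 * \sum_(j in T) geomean a (T :\ j).
Proof.
move=> a_ge0 k_gt0 cardT.
have prod_ge0 (S : {set I}) : 0 <= \prod_(i in S) a i by apply: prodr_ge0.
have prod_geomean : \prod_(j in T) geomean a (T :\ j) = \prod_(i in T) a i.
  transitivity (\prod_(j in T) (\prod_(i in T :\ j) a i) `^ k%:R^-1).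
    apply: eq_bigr => j jT; rewrite /geomean.
    by have := cardsD1 j T; rewrite jT cardT add1n => -[<-].
  (* The product over [T] is raised to the power [k], which cancels the exponent [1/k]; this needs
     [k] to be nonzero. *)
  rewrite -powR_prod // prod_setD1 cardT /= -powR_mulrn // -powRrM.
  by rewrite divff ?powRr1 // pnatr_eq0 -lt0n.
have sum_ge0 : 0 <= \sum_(j in T) geomean a (T :\ j).
  by apply: sumr_ge0 => j _; apply: powR_ge0.
have [] := @leif_AGM R I T (fun j => geomean a (T :\ j)).
  by move=> j _; apply: powR_ge0.
rewrite prod_geomean cardT mulrC => AGM _.
set m := _^-1 * _ in AGM *.
have m_ge0 : 0 <= m by rewrite mulr_ge0 ?invr_ge0.
(* AM-GM comes in the root-free form [\prod <= m ^+ k.+1], so [m] is written as a root and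
   monotonicity of [k.+1]-th roots applies. *)
have -> : m = (m ^+ k.+1) `^ k.+1%:R^-1.
  by rewrite -powR_mulrn // -powRrM divff ?powRr1 // pnatr_eq0.
rewrite /geomean cardT; apply: ge0_ler_powR; rewrite ?nnegrE ?invr_ge0 //.
exact: exprn_ge0.
Qed.

Lemma avg_geomean_le (R : realType) (I : finType) (a : I -> R) (k : nat) :
    (forall i, 0 <= a i) -> (0 < k < #|I|)%N ->
  'C(#|I|, k.+1)%:R^-1 * \sum_(T : {set I} | #|T| == k.+1) geomean a T
  <= 'C(#|I|, k)%:R^-1 * \sum_(S : {set I} | #|S| == k) geomean a S.
Proof.
move=> a_ge0 /andP[k_gt0 k_lt].
have bin1_gt0 : (0 : R) < 'C(#|I|, k.+1)%:R by rewrite ltr0n bin_gt0.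
have bin_neq0 : 'C(#|I|, k)%:R != 0 :> R.
  by rewrite pnatr_eq0 -lt0n bin_gt0 ltnW.
rewrite ler_pdivrMl // mulrA.
(* The factor [#|I| - k] is the multiplicity in [sum_setD1], and [k.+1%:R^-1] is the weight in the
   AM-GM bound for each [T]. *)
have -> : 'C(#|I|, k.+1)%:R / 'C(#|I|, k)%:R = k.+1%:R^-1 * (#|I| - k)%:R :> R.
  apply: (mulfI (_ : k.+1%:R != 0 :> R)); first by rewrite pnatr_eq0.
  rewrite !mulrA -natrM mul_bin_left natrM mulfK // divff ?mul1r //.
  by rewrite pnatr_eq0.
rewrite -mulrA mulr_natl -sum_setD1 mulr_sumr.
by apply: ler_sum => T /eqP cardT; apply: geomean_le_setD1.
Qed.

(** The diagonal entry is the quadratic form of [rho i] at row [x] of [U]. *)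
Lemma eigval_in_ge0 (R : realType) (d r : nat) (rho : 'I_r -> 'M[R[i]]_d)
    (U : 'M[R[i]]_d) (i : 'I_r) (x : 'I_d) :
  U \is unitarymx -> psdmx (rho i) -> 0 <= eigval_in rho U i x.
Proof.
move=> Uu [_ /(_ (row x U))]; rewrite /eigval_in conjymx //.
have -> : (row x U *m rho i *m ((row x U) ^t*)%sesqui) 0 0
        = (U *m rho i *m (U ^t*)%sesqui) x x.
  rewrite -row_mul !mxE; apply: eq_bigr => y _; by rewrite !mxE.
by rewrite lecE => /andP[].
Qed.

(** Moving the sum over [x] outside lets averages be compared separately at each [x]. *)
Lemma avg_fidelity_geomean (R : realType) (d r : nat)
    (rho : 'I_r -> 'M[R[i]]_d) (U : 'M[R[i]]_d) (k : nat) :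
    common_eigenbasis rho U ->
  avg_fidelity rho k = \sum_x 'C(#|'I_r|, k)%:R^-1 *
    \sum_(S : {set 'I_r} | #|S| == k) geomean (eigval_in rho U ^~ x) S.
Proof.
move=> Ue; rewrite -mulr_sumr card_ord /avg_fidelity; congr (_ * _).
rewrite [RHS]exchange_big /=; apply: eq_bigr => S _.
by rewrite (fidelityE S Ue).
Qed.

Theorem mainTheorem2 (R : realType) (d r : nat) (rho : 'I_r -> 'M[R[i]]_d)
    (r_ge3 : (3 <= r)%N)
    (rho_state : forall i, quantum_state (rho i))
    (rho_comm : forall i j, comm_mx (rho i) (rho j)) :
  forall k, (2 <= k < r)%N -> avg_fidelity rho k.+1 <= avg_fidelity rho k.
Proof.
move=> k /andP[k_ge2 k_lt].
have [U Ue] := common_eigenbasis_exists rho_state rho_comm.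
rewrite !(@avg_fidelity_geomean _ _ _ _ U) //.
apply: ler_sum => x _; apply: avg_geomean_le; last by rewrite card_ord k_lt ltnW.
move=> i; apply: eigval_in_ge0; first by case: Ue.
by case: (rho_state i).
Qed.
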